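(* Let $d\ge1$. There exist constants $c_1,c_2>0$, depending only on the dimension $d$, such that the following holds. Let $f$ be a probability density function on $\mathbb{R}^d$ and let $x\in\mathbb{R}^d$ be a Lebesgue point of $f$ such that $f(x)>0$. For each $n\ge1$ let $D_n^L(x)$ be the diameter of the cell $L_n(x)$ that contains $x$ in the Voronoi diagram generated by $\{X_1,\dots,X_n\}$, where $X_1,\dots,X_n$ are i.i.d. with density $f$. Then for every $t>0$, $$\limsup_{n\to\infty}\mathbb{P}\left(D_n^L(x)\ge\frac{t}{n^{1/d}}\right)\le c_1e^{-c_2f(x)t^d}.$$
   Context: $\|\cdot\|$ is the Euclidean norm on $\mathbb{R}^d$, $\lambda$ is Lebesgue measure, and $B_{z,r}$ is the open ball with center $z$ and radius $r$. A point $x\in\mathbb{R}^d$ is a Lebesgue point of $f$ if $\lim_{r\to0}\frac{1}{\lambda(B_{x,r})}\int_{B_{x,r}}|f(u)-f(x)|\,du=0$. The Voronoi diagram generated by $\{X_1,\dots,X_n\}$ is the collection of the cells $\{p\in\mathbb{R}^d:\ \|p-X_i\|\le\|p-X_j\|\ \text{for all } j\ne i\}$, $i=1,\dots,n$; the cell indexed by $i$ has nucleus $X_i$. For a fixed point $x$, $L_n(x)$ denotes the cell that contains $x$; it is almost surely unique, and its nucleus is the point among $X_1,\dots,X_n$ nearest to $x$. The diameter may be $+\infty$ if the cell is unbounded. *)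

(* Defs.v *)
From HB Require Import structures.
From mathcomp Require Import all_boot all_order all_algebra.
From mathcomp Require Import all_classical all_reals all_analysis.

Set Implicit Arguments.
Unset Strict Implicit.
Unset Printing Implicit Defensive.

Import Order.TTheory GRing.Theory Num.Theory.
Import numFieldNormedType.Exports.

Local Open Scope classical_set_scope.
Local Open Scope ring_scope.

(* R^d is the type of d-tuples, for which the library provides the sigma-algebra
   generated by the coordinates; over the Borel sets of R it is the Borel
   sigma-algebra of R^d. *)
Notation Rd R d := (d.-tuple (measurableTypeR R)) (only parsing).

Lemma behead_consK (T : Type) (d : nat) (x : T) (y : d.-tuple T) :
  [tuple of behead [tuple of x :: y]] = y.
Proof. exact/val_inj. Qed.

Section tuple_product.
Context (dT : measure_display) (T : measurableType dT) (R : realType) (n : nat).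
Variable m1 : {sigma_finite_measure set T -> \bar R}.
Variable m2 : {sigma_finite_measure set (n.-tuple T) -> \bar R}.

Definition pair_cons (p : (T * n.-tuple T)%type) : n.+1.-tuple T :=
  [tuple of p.1 :: p.2].

Lemma measurable_pair_cons : measurable_fun setT pair_cons.
Proof. exact: measurable_cons. Qed.

HB.instance Definition _ :=
  isMeasurableFun.Build _ _ _ _ pair_cons measurable_pair_cons.

Definition tuple_product : set (n.+1.-tuple T) -> \bar R :=
  pushforward (m1 \x m2)%E pair_cons.

Let tuple_product_set0 : tuple_product set0 = 0%E.
Proof. exact: measure0. Qed.

Let tuple_product_ge0 A : (0 <= tuple_product A)%E.
Proof. exact: measure_ge0. Qed.

Let tuple_product_sigma_additive : semi_sigma_additive tuple_product.
Proof. exact: measure_semi_sigma_additive. Qed.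

HB.instance Definition _ := isMeasure.Build _ _ _ tuple_product
  tuple_product_set0 tuple_product_ge0 tuple_product_sigma_additive.

Lemma tuple_productE (A : set T) (B : set (n.-tuple T)) :
  measurable A -> measurable B ->
  tuple_product [set p | A (thead p) /\ B [tuple of behead p]] =
  (m1 A * m2 B)%E.
Proof.
move=> mA mB; rewrite -product_measure1E// /tuple_product /pushforward.
congr (_ _); apply/seteqP; split=> -[x y] /=; rewrite theadE behead_consK.
  by case.
by case.
Qed.

Let tuple_product_sigma_finite : sigma_finite setT tuple_product.
Proof.
have /sigma_finiteP[F [TF ndF Foo]] := sigma_finiteT m1.
have /sigma_finiteP[G [TG ndG Goo]] := sigma_finiteT m2.
exists (fun k => [set p | F k (thead p) /\ G k [tuple of behead p]]).
  apply/seteqP; split=> // p _.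
  have [i _ Fi] : (\bigcup_i F i) (thead p) by rewrite -TF.
  have [j _ Gj] : (\bigcup_i G i) [tuple of behead p] by rewrite -TG.
  exists (maxn i j) => //; split.
    by move: Fi; exact/subsetPset/ndF/leq_maxl.
  by move: Gj; exact/subsetPset/ndG/leq_maxr.
move=> k; have [mF ?] := Foo k; have [mG ?] := Goo k; split.
  rewrite -[X in measurable X]setTI; apply: measurableI => //.
  apply: measurableI.
    by rewrite -[X in measurable X]setTI; exact: measurable_tnth.
  by rewrite -[X in measurable X]setTI; exact: measurable_behead.
by rewrite tuple_productE// lte_mul_pinfty// ge0_fin_numE.
Qed.

HB.instance Definition _ := Measure_isSigmaFinite.Build _ _ _
  tuple_product tuple_product_sigma_finite.

End tuple_product.

(* Lebesgue measure on (the Borel sets of) R^d: the d-fold product of the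
   one-dimensional one, characterized by [lebesgueE] below. *)
Fixpoint lebesgue (R : realType) (d : nat) :
    {sigma_finite_measure set (Rd R d) -> \bar R} :=
  match d with
  | 0 => @dirac _ (Rd R 0) [tuple] R
  | d'.+1 => tuple_product (@lebesgue_measure R) (lebesgue R d')
  end.

Lemma lebesgueE (R : realType) (d : nat) (A : 'I_d -> set (measurableTypeR R)) :
  (forall i, measurable (A i)) ->
  lebesgue R d [set p | forall i, A i (tnth p i)] =
  (\prod_(i < d) lebesgue_measure (A i))%E.
Proof.
elim: d A => [|d IH] A mA.
  rewrite big_ord0 /= diracE mem_set//; by case.
rewrite big_ord_recl -IH// -tuple_productE//; last first.
  rewrite (_ : mkset _ = \bigcap_(i in [set: 'I_d])
      ((fun p : Rd R d => tnth p i) @^-1` A (lift ord0 i))); last first.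
    by apply/seteqP; split=> p h i => [_|]; exact: h.
  apply: fin_bigcap_measurable => // i _.
  by rewrite -[X in measurable X]setTI; exact: measurable_tnth.
have tnth_behead (p : Rd R d.+1) i :
    tnth [tuple of behead p] i = tnth p (lift ord0 i).
  by rewrite [in RHS](tuple_eta p) tnthS.
congr (_ _); apply/seteqP; split=> p /=.
- move=> Ap; split; first exact: Ap.
  by move=> i; rewrite tnth_behead; exact: Ap.
- move=> [Ap0 Ap] i; case: (unliftP ord0 i) => [j|] ->; last exact: Ap0.
  by rewrite -tnth_behead; exact: Ap.
Qed.

Section euclidean.
Context (R : realType) (d : nat).
Implicit Types (p q x : Rd R d) (r : R) (f : Rd R d -> R).

(* The Euclidean distance; the library's own norm on vectors is the maximum
   norm. *)
Definition edist p q : R :=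
  Num.sqrt (\sum_(i < d) ((tnth p i : R) - (tnth q i : R)) ^+ 2).

Definition eball x r : set (Rd R d) := [set p | edist x p < r].

Definition diameter (A : set (Rd R d)) : \bar R :=
  ereal_sup [set (edist p q)%:E | p in A & q in A].

Definition prob_density f :=
  [/\ measurable_fun setT f, (forall u, 0 <= f u) &
      (\int[lebesgue R d]_u (f u)%:E = 1)%E].

Definition lebesgue_point f x :=
  ((lebesgue R d (eball x r))^-1 *
     \int[lebesgue R d]_(u in eball x r) `|f u - f x|%:E)%E
    @[r --> (0 : R)^'+] --> 0%E.

(* The cell with nucleus [X i] in the Voronoi diagram generated by [X]. *)
Definition voronoi_cell (n : nat) (X : 'I_n -> Rd R d) (i : 'I_n) :
    set (Rd R d) :=
  [set p | forall j, j != i -> edist p (X i) <= edist p (X j)].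

(* The cell that contains x. If x lies on the boundary of several cells, which
   happens with probability 0 for a sample with a density, it is the one of
   least index. *)
Definition cell_of (n : nat) (X : 'I_n -> Rd R d) x : set (Rd R d) :=
  if [pick i | `[< voronoi_cell X i x >]] is Some i then voronoi_cell X i
  else set0.

(* The [set0] branch of [cell_of] is only taken when n = 0. *)
Lemma cell_ofP (n : nat) (X : 'I_n -> Rd R d) x : (0 < n)%N ->
  cell_of X x x /\ exists i, cell_of X x = voronoi_cell X i.
Proof.
case: n X => // n X _; rewrite /cell_of; case: pickP => [i /asboolP xi|noc].
  by split => //; exists i.
pose i := [arg min_(k < ord0) edist x (X k)]%O.
have := noc i; move/negbT/asboolPn; case => j _.
by rewrite /i; case: arg_minP => // k _; exact.
Qed.

End euclidean.

Section random_points.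
Context (dO : measure_display) (Omega : measurableType dO) (R : realType).
Context (d : nat) (P : probability Omega R).

Definition mutually_independent (X : nat -> {RV P >-> Rd R d}) :=
  forall (J : seq nat) (A : nat -> set (Rd R d)),
    uniq J -> (forall i, measurable (A i)) ->
    P (\bigcap_(i in [set` J]) (X i @^-1` A i)) =
    (\prod_(i <- J) P (X i @^-1` A i))%E.

Definition has_density (X : {RV P >-> Rd R d}) (f : Rd R d -> R) :=
  forall A, measurable A ->
    distribution P X A = (\int[lebesgue R d]_(u in A) (f u)%:E)%E.

Definition iid_with_density (X : nat -> {RV P >-> Rd R d})
    (f : Rd R d -> R) :=
  mutually_independent X /\ forall i, has_density (X i) f.

(* D_n^L(x): the diameter of the cell containing x in the Voronoi diagram of the
   first n points. *)
Definition cell_diameter (X : nat -> {RV P >-> Rd R d}) (x : Rd R d)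
    (n : nat) (w : Omega) : \bar R :=
  diameter (cell_of (fun i : 'I_n => X i w) x).

End random_points.

(* Main.v *)
(* Put h = t n^(-1/d) / (12 d^2) and tile a box of half-side 3dh around x by
   finitely many cubes of side h, their number depending only on d. If every cube
   contains a sample point, then the nucleus of the cell of x is within dh of x,
   whereas a point of the cell at sup-distance exactly 3dh from x (one exists, by
   convexity, as soon as the cell leaves the box) would have a sample point
   within dh: it would be closer to that point than to the nucleus. So a cell of
   diameter at least t n^(-1/d) forces one of the cubes to be empty. The cubes lie
   in balls around x of comparable volume, so at a Lebesgue point each of them
   eventually has mass at least f(x) h^d / 2, and it is empty with probability at
   most exp(- n f(x) h^d / 2).
   The inclusion of events bounds the probability only if the diameter event is
   measurable, which holds because the diameter of a cell is already approximated
   by pairs of rational points of the cell. *)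

Require Import Defs.
From HB Require Import structures.
From mathcomp Require Import all_boot all_order all_algebra.
From mathcomp Require Import all_classical all_reals all_analysis.
From mathcomp Require Import measurable_realfun ring lra.

Import Order.TTheory GRing.Theory Num.Theory.
Import numFieldNormedType.Exports.

Local Open Scope classical_set_scope.
Local Open Scope ring_scope.

(* mathcomp-analysis also has an [edist], the extended metric of a pseudometric
   space. *)
Local Notation edist := Defs.edist.

(** * Geometry of Voronoi cells and of the grid of cubes *)

Section geometry.
Set Implicit Arguments.
Unset Strict Implicit.
Context {R : realType} {d : nat}.
Implicit Types (p q x a b : Rd R d).

Lemma coord_le_edist p q (l : 'I_d) :
  `|(tnth p l : R) - tnth q l| <= edist p q.
Proof.
rewrite -sqrtr_sqr /edist ler_sqrt; last by apply: sumr_ge0 => i _; exact: sqr_ge0.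
rewrite (bigD1 l)//= lerDl; apply: sumr_ge0 => i _; exact: sqr_ge0.
Qed.

(** The sharp factor is the square root of d; the cruder d, from d ≤ d^2, keeps the later constants
    free of roots. *)
Lemma edist_le_coord p q (e : R) : 0 <= e ->
  (forall l : 'I_d, `|(tnth p l : R) - tnth q l| <= e) -> edist p q <= d%:R * e.
Proof.
move=> e0 pqe.
have de0 : 0 <= d%:R * e by rewrite mulr_ge0.
rewrite /edist -(ger0_norm de0) -sqrtr_sqr ler_sqrt ?sqr_ge0//.
apply: (@le_trans _ _ (\sum_(l < d) e ^+ 2)).
  by apply: ler_sum => l _; rewrite -real_normK ?num_real// ler_sqr ?nnegrE.
rewrite sumr_const card_ord -[leLHS]mulr_natl exprMn ler_wpM2r ?sqr_ge0//.
case: (d) => [|m]; first by rewrite expr0n.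
by rewrite expr2 ler_peMr// ler1n.
Qed.

Lemma edistC p q : edist p q = edist q p.
Proof. by congr Num.sqrt; apply: eq_bigr => i _; rewrite -sqrrN opprB. Qed.

(** This is |p-b|^2 - |p-a|^2. The squares of the coordinates of [p] cancel, so it is affine in [p],
    and being nearer to [a] than to [b] is a half-space condition. *)
Definition power_gap p a b : R :=
  \sum_(l < d) (((tnth p l : R) - tnth b l) ^+ 2 - ((tnth p l : R) - tnth a l) ^+ 2).

Lemma edist_le_power_gap p a b :
  (edist p a <= edist p b) = (0 <= power_gap p a b).
Proof.
rewrite /edist ler_sqrt; last by apply: sumr_ge0 => i _; exact: sqr_ge0.
by rewrite /power_gap sumrB subr_ge0.
Qed.

Definition segment_point p q (s : R) : Rd R d :=
  [tuple (1 - s) * (tnth p l : R) + s * (tnth q l : R) | l < d].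

Lemma power_gap_segment p q a b s : power_gap (segment_point p q s) a b =
  (1 - s) * power_gap p a b + s * power_gap q a b.
Proof.
rewrite /power_gap !mulr_sumr -big_split /=; apply: eq_bigr => l _.
by rewrite tnth_mktuple; ring.
Qed.

Lemma power_gapxx p a : power_gap p a a = 0.
Proof. by rewrite /power_gap big1// => l _; rewrite subrr. Qed.

(** This gap is |a-b|^2: a nucleus lies strictly inside every half-space that cuts out its cell,
    apart from those of coinciding sample points. *)
Lemma power_gap_nucleus_gt0 a b : a != b -> 0 < power_gap a a b.
Proof.
move=> ab; have ge0 : 0 <= power_gap a a b.
  by apply: sumr_ge0 => l _; rewrite subrr expr0n subr0 sqr_ge0.
rewrite lt_neqAle ge0 andbT eq_sym; apply: contra ab.
rewrite /power_gap psumr_eq0 => [|l _]; last by rewrite subrr expr0n subr0 sqr_ge0.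
move=> /allP H; apply/eqP/eq_from_tnth => l.
have := H l (mem_index_enum l).
by rewrite /= subrr expr0n subr0 sqrf_eq0 subr_eq0 => /eqP.
Qed.

(** Both points move by the same homothety, of centre [a] and ratio 1 - s. *)
Lemma edist_segment p q a s : 0 <= s -> s <= 1 ->
  edist (segment_point p a s) (segment_point q a s) = (1 - s) * edist p q.
Proof.
move=> s0 s1; rewrite /edist.
transitivity (Num.sqrt ((1 - s) ^+ 2 *
    \sum_(l < d) ((tnth p l : R) - tnth q l) ^+ 2)).
  by congr Num.sqrt; rewrite mulr_sumr; apply: eq_bigr => l _;
    rewrite !tnth_mktuple; ring.
by rewrite sqrtrM ?sqr_ge0// sqrtr_sqr ger0_norm// subr_ge0.
Qed.

(** A cell is an intersection of half-spaces: each gap is affine along the segment and nonnegative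
    at its ends. *)
Lemma voronoi_cell_convex n (X : 'I_n -> Rd R d) i p q s : 0 <= s -> s <= 1 ->
  voronoi_cell X i p -> voronoi_cell X i q ->
  voronoi_cell X i (segment_point p q s).
Proof.
move=> s0 s1 Xp Xq j ji; have := Xp j ji; have := Xq j ji.
rewrite !edist_le_power_gap power_gap_segment => q0 p0.
by rewrite addr_ge0// mulr_ge0// subr_ge0.
Qed.

Lemma voronoi_cell_nearest n (X : 'I_n -> Rd R d) i p j :
  voronoi_cell X i p -> edist p (X i) <= edist p (X j).
Proof. by move=> Xp; case: (eqVneq j i) => [->//|]; exact: Xp. Qed.

(* The shift by N makes the cubes cover the box of half-side N h centred at x. *)
Definition grid_side (N : nat) x (h : R) (k : {ffun 'I_d -> 'I_(N.*2.+1)})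
    (l : 'I_d) : interval R :=
  `[(tnth x l : R) + h * ((k l)%:R - N%:R),
    (tnth x l : R) + h * ((k l)%:R - N%:R + 1)[.

Definition grid_cube (N : nat) x (h : R) (k : {ffun 'I_d -> 'I_(N.*2.+1)}) :
    set (Rd R d) :=
  [set p | forall l, [set` grid_side x h k l] (tnth p l : R)].

Lemma grid_cube_cover N x h p : 0 < h ->
  (forall l : 'I_d, `|(tnth p l : R) - tnth x l| <= N%:R * h) ->
  exists k : {ffun 'I_d -> 'I_(N.*2.+1)}, grid_cube x h k p.
Proof.
(* The index along axis [l] is the integer part of [u l]. The sides being half-open, the closed
   right face of the box needs the index 2N, hence 2N+1 cubes per axis. *)
move=> h0 px; pose u (l : 'I_d) := ((tnth p l : R) - tnth x l) / h + N%:R.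
have uB l : 0 <= u l <= (N.*2)%:R.
  have : `|((tnth p l : R) - tnth x l) / h| <= N%:R.
    by rewrite normrM normfV (gtr0_norm h0) ler_pdivrMr.
  by rewrite /u -addnn natrD ler_norml => /andP[? ?]; apply/andP; split; lra.
have uI l : (Num.truncn (u l))%:R <= u l < (Num.truncn (u l)).+1%:R.
  by apply: truncn_itv; case/andP: (uB l).
have ul l : (Num.truncn (u l) < N.*2.+1)%N.
  rewrite ltnS -(@ler_nat R); case/andP: (uB l) => _; apply: le_trans.
  by case/andP: (uI l).
exists [ffun l => Ordinal (ul l)] => l /=.
rewrite /grid_side in_itv /= ffunE /=.
have /andP[] := uI l; rewrite -natr1.
have -> : (tnth p l : R) = tnth x l + h * (u l - N%:R).
  by rewrite /u addrK mulrC divfK ?gt_eqF// addrC subrK.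
by move=> v1 v2; rewrite lerD2l ltrD2l ler_pM2l// ltr_pM2l//; lra.
Qed.

Lemma grid_cube_coord N x h (k : {ffun 'I_d -> 'I_(N.*2.+1)}) p q (l : 'I_d) :
  grid_cube x h k p -> grid_cube x h k q ->
  `|(tnth p l : R) - tnth q l| <= h.
Proof.
move=> /(_ l) + /(_ l); rewrite /= /grid_side !in_itv /=.
rewrite !mulrDr !mulr1 => /andP[? ?] /andP[? ?].
rewrite ler_norml; lra.
Qed.

Lemma voronoi_cell_bounded n (X : 'I_n -> Rd R d) i x h p (l : 'I_d) : 0 < h ->
  (forall k : {ffun 'I_d -> 'I_((3 * d).*2.+1)}, exists j, grid_cube x h k (X j)) ->
  voronoi_cell X i x -> voronoi_cell X i p ->
  `|(tnth p l : R) - tnth x l| <= (3 * d)%:R * h.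
Proof.
move=> h0 hit Xx Xp.
have d0 : (0 < d)%N by case: (d) l => // -[].
(* A point of the cell inside the box shares a cube with a sample point, which is within d h of it;
   the nucleus is no farther. *)
have near_nucleus q :
    (forall m : 'I_d, `|(tnth q m : R) - tnth x m| <= (3 * d)%:R * h) ->
    voronoi_cell X i q -> edist q (X i) <= d%:R * h.
  move=> /(grid_cube_cover h0)[k kq] Xq; have [j kj] := hit k.
  apply: (le_trans (voronoi_cell_nearest j Xq)).
  by apply: edist_le_coord => [|m]; [exact: ltW|exact: (grid_cube_coord m kq kj)].
have xi : edist x (X i) <= d%:R * h.
  by apply: near_nucleus => // m; rewrite subrr normr0 mulr_ge0// ltW.
rewrite leNgt; apply/negP => far.
pose c (m : 'I_d) : R := `|(tnth p m : R) - tnth x m|.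
have [m _ cm] := @arg_maxP _ _ _ l xpredT c isT.
set r := (3 * d)%:R * h in far near_nucleus.
have rM : r < c m by apply: (lt_le_trans far); exact: cm.
have r0 : 0 < r by rewrite mulr_gt0// ltr0n muln_gt0.
have M0 : 0 < c m by apply: lt_trans rM.
(* With [m] the coordinate of largest deviation, this [s] pulls [p] back towards [x] to sup-distance
   exactly [r], so [q] is in the box and, by convexity, in the cell. *)
pose s := r / c m; pose q := segment_point x p s.
have s0 : 0 <= s by rewrite divr_ge0// ltW.
have s1 : s <= 1 by rewrite ler_pdivrMr// mul1r ltW.
have qE o : `|(tnth q o : R) - tnth x o| = s * c o.
  rewrite tnth_mktuple /c -[X in X * `|_|](ger0_norm s0) -normrM; congr `| _ |.
  by ring.
have qi : edist q (X i) <= d%:R * h.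
  apply: near_nucleus; last exact: voronoi_cell_convex.
  move=> o; rewrite qE; apply: (@le_trans _ _ (s * c m)).
    by apply: ler_wpM2l => //; exact: cm.
  by rewrite /s divfK ?gt_eqF.
have qm : `|(tnth q m : R) - tnth x m| = r by rewrite qE /s divfK ?gt_eqF.
(* Passing through the nucleus, [q] and [x] differ by at most 2 d h in coordinate [m], whereas [r]
   is 3 d h. *)
have : r <= d%:R * h + d%:R * h.
  rewrite -qm; apply: (le_trans (ler_distD (tnth (X i) m : R) _ _)).
  apply: lerD; first exact: le_trans (coord_le_edist _ _ _) qi.
  by rewrite distrC; exact: le_trans (coord_le_edist _ _ _) xi.
rewrite /r natrM; apply/negP; rewrite -ltNge.
have : 0 < d%:R * h by rewrite mulr_gt0// ltr0n.
by rewrite -mulrA; set z := d%:R * h; lra.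
Qed.

(** Two points of the cell differ by at most twice 3 d h in each coordinate; the outer factor d
    turns this into a Euclidean bound. *)
Lemma diameter_cell_of_le n (X : 'I_n -> Rd R d) x h : 0 < h ->
  (forall k : {ffun 'I_d -> 'I_((3 * d).*2.+1)}, exists j, grid_cube x h k (X j)) ->
  (diameter (cell_of X x) <= (d%:R * (6 * d%:R * h))%:E)%E.
Proof.
move=> h0 hit; apply: ge_ereal_sup => _ [p Cp [q Cq <-]].
rewrite lee_fin; apply: edist_le_coord => [|l].
  by rewrite !mulr_ge0// ltW.
move: Cp Cq; rewrite /cell_of; case: pickP => // i /asboolP Xx Xp Xq.
have := voronoi_cell_bounded l h0 hit Xx Xp.
have := voronoi_cell_bounded l h0 hit Xx Xq.
rewrite distrC => xq px; apply: (le_trans (ler_distD (tnth x l : R) _ _)).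
apply: (le_trans (lerD px xq)); rewrite natrM; lra.
Qed.

End geometry.

(** * Measurability of the diameter event *)

Section measurability.
Set Implicit Arguments.
Unset Strict Implicit.
Context {R : realType} {d : nat}.
Implicit Types (p q x a b : Rd R d).

Lemma measurable_edist (dT : measure_display) (T : measurableType dT)
    (f g : T -> Rd R d) : measurable_fun setT f -> measurable_fun setT g ->
  measurable_fun setT (fun w => edist (f w) (g w)).
Proof.
move=> mf mg; apply: (measurableT_comp (f := @Num.sqrt R)).
  by apply: continuous_measurable_fun; exact: sqrt_continuous.
apply: measurable_sum => l; apply: measurable_funX; apply: measurable_funB.
  exact: measurableT_comp (measurable_tnth l) mf.
exact: measurableT_comp (measurable_tnth l) mg.
Qed.

Lemma measurable_cst_prop (dT : measure_display) (T : measurableType dT)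
    (Q : Prop) : measurable [set _ : T | Q].
Proof.
have [HQ|HQ] := pselect Q.
  by rewrite (_ : [set _ | _] = setT)//; apply/seteqP; split.
by rewrite (_ : [set _ | _] = set0)//; apply/seteqP; split.
Qed.

Lemma measurable_eball x r : measurable (Defs.eball x r).
Proof.
rewrite (_ : Defs.eball x r = (fun p => edist x p < r) @^-1` [set true]).
  rewrite -[X in measurable X]setTI.
  by apply: measurable_fun_ltr => //; exact: measurable_edist.
by apply/seteqP; split => p.
Qed.

Lemma measurable_voronoi_cell (dT : measure_display) (T : measurableType dT)
    n (X : 'I_n -> T -> Rd R d) i p : (forall j, measurable_fun setT (X j)) ->
  measurable [set w | voronoi_cell (X ^~ w) i p].
Proof.
move=> mX; rewrite (_ : [set w | _] = \bigcap_(j in [set j | j != i])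
    [set w | edist p (X i w) <= edist p (X j w)]).
  apply: fin_bigcap_measurable => [|j _]; first exact: finite_finset.
  rewrite -[X in measurable X]setTI.
  by apply: measurable_fun_le => //; exact: measurable_edist.
by apply/seteqP; split.
Qed.

Definition rat_point (u : d.-tuple rat) : Rd R d := [tuple ratr (tnth u l) | l < d].

Lemma rat_point_cvg p : exists u : nat -> d.-tuple rat,
  forall l, (tnth (rat_point (u m)) l : R) @[m --> \oo] --> (tnth p l : R).
Proof.
have /choice[u uP] : forall m : nat, exists u : d.-tuple rat, forall l : 'I_d,
    `|(tnth (rat_point u) l : R) - tnth p l| < m.+1%:R^-1.
  move=> m; have /fin_all_exists[u uP] : forall l : 'I_d, exists r : rat,
      `|(ratr r : R) - tnth p l| < m.+1%:R^-1.
    move=> l; have m0 : 0 < m.+1%:R^-1 :> R by rewrite invr_gt0.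
    have /rat_in_itvoo[r] : (tnth p l : R) < (tnth p l : R) + m.+1%:R^-1.
      by rewrite ltrDl.
    rewrite in_itv /= => /andP[pr rp]; exists r.
    by rewrite ltr_distl rp andbT (lt_trans _ pr)// ltrBlDr ltrDl.
  by exists [tuple u l | l < d] => l; rewrite !tnth_mktuple.
exists u => l; apply/cvgrPdist_lt => e e0.
have /cvgrPdist_lt/(_ _ e0) := @cvg_harmonic R.
apply: filterS => m; rewrite sub0r normrN /= ger0_norm ?invr_ge0//.
by rewrite distrC; exact: lt_trans (uP m l).
Qed.

Lemma cvg_ord_sum (h : 'I_d -> nat -> R) (a : 'I_d -> R) :
  (forall l, h l m @[m --> \oo] --> a l) ->
  \sum_(l < d) h l m @[m --> \oo] --> \sum_(l < d) a l.
Proof. by move=> ha; apply: cvg_big => //; exact: add_continuous. Qed.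

Lemma cvg_edist (u v : nat -> Rd R d) p q :
  (forall l, (tnth (u m) l : R) @[m --> \oo] --> (tnth p l : R)) ->
  (forall l, (tnth (v m) l : R) @[m --> \oo] --> (tnth q l : R)) ->
  edist (u m) (v m) @[m --> \oo] --> edist p q.
Proof.
move=> up vq; rewrite /Defs.edist.
apply: (@continuous_cvg _ _ _ _ _
  (fun m => \sum_(l < d) ((tnth (u m) l : R) - tnth (v m) l) ^+ 2)
  (@Num.sqrt R)); first exact: sqrt_continuous.
apply: cvg_ord_sum => l; under eq_fun do rewrite expr2; rewrite expr2.
by apply: cvgM; apply: cvgB.
Qed.

Lemma cvg_power_gap (u : nat -> Rd R d) p a b :
  (forall l, (tnth (u m) l : R) @[m --> \oo] --> (tnth p l : R)) ->
  power_gap (u m) a b @[m --> \oo] --> power_gap p a b.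
Proof.
move=> up; apply: cvg_ord_sum => l.
apply: cvgB; under eq_fun do rewrite expr2; rewrite expr2;
  by apply: cvgM; apply: cvgB => //; exact: cvg_cst.
Qed.

(* Contracting the cell towards its nucleus moves it into its interior, where
   rational points are dense. *)
Lemma voronoi_cell_rat_dense n (X : 'I_n -> Rd R d) i p (s : R) : 0 < s -> s <= 1 ->
  voronoi_cell X i p ->
  exists u : nat -> d.-tuple rat,
    (forall l, (tnth (rat_point (u m)) l : R) @[m --> \oo] -->
               (tnth (segment_point p (X i) s) l : R)) /\
    \forall m \near \oo, voronoi_cell X i (rat_point (u m)).
Proof.
move=> s0 s1 Xp; have [u uq] := rat_point_cvg (segment_point p (X i) s).
exists u; split => //.
suff : \forall m \near \oo, forall j : 'I_n,
    0 <= power_gap (rat_point (u m)) (X i) (X j).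
  by apply: filterS => m H j _; rewrite edist_le_power_gap.
(* There are finitely many [j], so each may have its own threshold. If two sample points coincide,
   their gap vanishes identically. *)
apply: filter_forall => j; have [<-|ij] := eqVneq (X i) (X j).
  by apply: nearW => m; rewrite power_gapxx.
have gap0 : 0 < power_gap (segment_point p (X i) s) (X i) (X j).
  rewrite power_gap_segment ltr_wpDl//.
    rewrite mulr_ge0 ?subr_ge0// -edist_le_power_gap.
    exact: voronoi_cell_nearest.
  by rewrite mulr_gt0// power_gap_nucleus_gt0.
near=> m; apply/ltW; near: m; apply: cvgr_gt gap0.
exact: cvg_power_gap.
Unshelve. all: by end_near.
Qed.

(** Both points are contracted towards the nucleus by a ratio 1 - e so close to 1 that their
    distance still exceeds [s], then approximated by rational points of the cell. *)
Lemma voronoi_cell_rat_pair n (X : 'I_n -> Rd R d) i p q (s : R) :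
  voronoi_cell X i p -> voronoi_cell X i q -> s < edist p q ->
  exists uv : d.-tuple rat * d.-tuple rat,
    [/\ voronoi_cell X i (rat_point uv.1), voronoi_cell X i (rat_point uv.2) &
        s < edist (rat_point uv.1) (rat_point uv.2)].
Proof.
move=> Xp Xq spq.
have [e e0 [e1 spqe]] : exists2 e : R, 0 < e & e <= 1 /\ s < (1 - e) * edist p q.
  have /cvgrPdist_lt : (1 - r) * edist p q @[r --> (0:R)^'+] --> (1 - 0) * edist p q.
    apply: cvg_at_right_filter; apply: cvgMl; apply: cvgB => //; exact: cvg_cst.
  rewrite subr0 mul1r => /(_ (edist p q - s)); rewrite subr_gt0 => /(_ spq) H.
  near (0:R)^'+ => e; exists e => //; split.
    by near: e; exact: nbhs_right_le.
  suff : `|edist p q - (1 - e) * edist p q| < edist p q - s.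
    by move=> /(le_lt_trans (ler_norm _)); rewrite ltrD2l ltrN2.
  by near: e.
have [u [up uX]] := voronoi_cell_rat_dense e0 e1 Xp.
have [v [vq vX]] := voronoi_cell_rat_dense e0 e1 Xq.
have := cvg_edist up vq; rewrite edist_segment ?(ltW e0)// => uv.
near \oo => m; exists (u m, v m); split => /=.
- by near: m.
- by near: m.
- by near: m; exact: (cvgr_gt _ uv).
Unshelve. all: by end_near.
Qed.

(** The supremum need not be attained, so pairs are sought beyond every level s - 1/(m+1); this
    makes the condition countable. *)
Lemma diameter_voronoi_cell_ge n (X : 'I_n -> Rd R d) i (s : R) :
  (s%:E <= diameter (voronoi_cell X i))%E <->
  forall m : nat, exists uv : d.-tuple rat * d.-tuple rat,
    [/\ voronoi_cell X i (rat_point uv.1), voronoi_cell X i (rat_point uv.2) &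
        s - m.+1%:R^-1 < edist (rat_point uv.1) (rat_point uv.2)].
Proof.
split=> [sD m|H].
  have : ((s - m.+1%:R^-1)%:E < diameter (voronoi_cell X i))%E.
    by apply: lt_le_trans sD; rewrite lte_fin ltrBlDr ltrDl invr_gt0.
  case/ereal_sup_gt => _ [p Xp [q Xq <-]]; rewrite lte_fin.
  exact: voronoi_cell_rat_pair.
apply/lee_subgt0Pr => e e0; have [m me] : exists m : nat, m.+1%:R^-1 < e.
  have /cvgrPdist_lt/(_ _ e0)[m _ /(_ m (leqnn m))] := @cvg_harmonic R.
  by rewrite sub0r normrN /= ger0_norm ?invr_ge0// => ?; exists m.
have [uv [Xu Xv suv]] := H m.
apply: (@le_trans _ _ (edist (rat_point uv.1) (rat_point uv.2))%:E).
  by rewrite -EFinB lee_fin (le_trans _ (ltW suv))// lerD2l lerN2 ltW.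
by apply: ereal_sup_ubound; exists (rat_point uv.1) => //; exists (rat_point uv.2).
Qed.

Lemma measurable_diameter_voronoi_cell_ge (dT : measure_display)
    (T : measurableType dT) n (X : 'I_n -> T -> Rd R d) i (s : R) :
  (forall j, measurable_fun setT (X j)) ->
  measurable [set w | (s%:E <= diameter (voronoi_cell (X ^~ w) i))%E].
Proof.
move=> mX; rewrite (_ : [set w | _] = \bigcap_m
  \bigcup_(uv : d.-tuple rat * d.-tuple rat)
    ([set w | voronoi_cell (X ^~ w) i (rat_point uv.1)] `&`
     [set w | voronoi_cell (X ^~ w) i (rat_point uv.2)] `&`
     [set _ : T | s - m.+1%:R^-1 < edist (rat_point uv.1) (rat_point uv.2)])).
  apply: bigcapT_measurable => m; apply: countable_bigcupT_measurable => // uv.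
  apply: measurableI; last exact: measurable_cst_prop.
  by apply: measurableI; exact: measurable_voronoi_cell.
apply/seteqP; split=> w /=.
  move=> /diameter_voronoi_cell_ge + m _ => /(_ m)[uv [? ? ?]].
  by exists uv.
move=> H; apply/diameter_voronoi_cell_ge => m; have [uv _ [[? ?] ?]] := H m I.
by exists uv.
Qed.

(* The cell is selected by the finite vector of truth values of the events
   "x lies in the cell of nucleus i", so the event is a finite union over these
   vectors. *)
Lemma measurable_diameter_cell_of_ge (dT : measure_display)
    (T : measurableType dT) n (X : 'I_n -> T -> Rd R d) x (s : R) :
  (forall j, measurable_fun setT (X j)) ->
  measurable [set w | (s%:E <= diameter (cell_of (X ^~ w) x))%E].
Proof.
move=> mX; pose sel (b : {ffun 'I_n -> bool}) w :=
  if [pick i | b i] is Some i then voronoi_cell (X ^~ w) i else set0.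
rewrite (_ : [set w | _] = \bigcup_(b : {ffun 'I_n -> bool})
   ((\bigcap_i [set w | `[< voronoi_cell (X ^~ w) i x >] = b i]) `&`
    [set w | (s%:E <= diameter (sel b w))%E])).
  apply: fin_bigcup_measurable => [|b _]; first exact: finite_finset.
  apply: measurableI.
    apply: fin_bigcap_measurable => [|i _]; [exact: finite_finset|case: (b i)].
      rewrite (_ : [set w | _] = [set w | voronoi_cell (X ^~ w) i x]).
        exact: measurable_voronoi_cell.
      by apply/seteqP; split => w /= /asboolP.
    rewrite (_ : [set w | _] = ~` [set w | voronoi_cell (X ^~ w) i x]).
      by apply: measurableC; exact: measurable_voronoi_cell.
    by apply/seteqP; split => w /=; [move/negbT/asboolPn|move/asboolPn/negbTE].
  rewrite /sel; case: pickP => [i _|_]; first exact: measurable_diameter_voronoi_cell_ge.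
  exact: measurable_cst_prop.
apply/seteqP; split=> w /=.
  move=> sD; exists [ffun i => `[< voronoi_cell (X ^~ w) i x >]] => //; split.
    by move=> i _ /=; rewrite ffunE.
  rewrite /= /sel; move: sD; rewrite /cell_of.
  by under [in X in _ -> X]eq_pick => i do rewrite ffunE.
by move=> [b _ [bE]]; rewrite /= /sel /cell_of (eq_pick (fun i => bE i I)).
Qed.

End measurability.

(** * Volumes of cubes and balls, and the mass of a cube near a Lebesgue point *)

Section volumes.
Set Implicit Arguments.
Unset Strict Implicit.
Context {R : realType} {d : nat}.
Implicit Types (p q x : Rd R d).

Lemma measurable_box (A : 'I_d -> set (measurableTypeR R)) :
  (forall l, measurable (A l)) ->
  measurable [set p : Rd R d | forall l, A l (tnth p l)].
Proof.
move=> mA; rewrite (_ : [set p | _] =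
    \bigcap_(l in [set: 'I_d]) ((fun p : Rd R d => tnth p l) @^-1` A l)).
  apply: fin_bigcap_measurable => [|l _]; first exact: finite_finset.
  by rewrite -[X in measurable X]setTI; exact: measurable_tnth.
by apply/seteqP; split=> p H l => [_|]; exact: H.
Qed.

Lemma lebesgue_box (A : 'I_d -> set (measurableTypeR R)) (r : R) :
  (forall l, measurable (A l)) -> (forall l, lebesgue_measure (A l) = r%:E) ->
  lebesgue R d [set p | forall l, A l (tnth p l)] = (r ^+ d)%:E.
Proof.
move=> mA Ar; rewrite lebesgueE//.
under eq_bigr do rewrite Ar.
by rewrite prodEFin prodr_const card_ord.
Qed.

Lemma measurable_grid_cube N x h (k : {ffun 'I_d -> 'I_(N.*2.+1)}) :
  measurable (grid_cube x h k).
Proof.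
by apply: (measurable_box (A := fun l => [set` grid_side x h k l])) => l;
  exact: measurable_itv.
Qed.

Lemma lebesgue_grid_cube N x h (k : {ffun 'I_d -> 'I_(N.*2.+1)}) : 0 < h ->
  lebesgue R d (grid_cube x h k) = (h ^+ d)%:E.
Proof.
move=> h0; apply: (lebesgue_box (A := fun l => [set` grid_side x h k l])) => l.
  exact: measurable_itv.
rewrite /grid_side [LHS]lebesgue_measure_itv /= lte_fin ltrD2l ltr_pM2l// ltrDl ltr01.
by rewrite -EFinB; congr _%:E; ring.
Qed.

Lemma lebesgue_eball_le x (r : R) : 0 < r ->
  (lebesgue R d (Defs.eball x r) <= ((2 * r) ^+ d)%:E)%E.
Proof.
move=> r0; pose A (l : 'I_d) : set (measurableTypeR R) :=
  [set` `[(tnth x l : R) - r, (tnth x l : R) + r]].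
have mA l : measurable (A l) by exact: measurable_itv.
rewrite -(lebesgue_box mA) => [|l]; last first.
  rewrite [LHS]lebesgue_measure_itv /= lte_fin ltrD2l gtrN// -EFinB.
  by congr _%:E; ring.
apply: le_measure; rewrite ?inE.
- exact: measurable_eball.
- exact: measurable_box.
move=> p xp l; rewrite /A /= in_itv /= -ler_distl distrC.
exact: le_trans (coord_le_edist _ _ _) (ltW xp).
Qed.

Lemma grid_cube_sub_eball N x h (k : {ffun 'I_d -> 'I_(N.*2.+1)}) : 0 < h ->
  (0 < d)%N -> grid_cube x h k `<=` Defs.eball x (d%:R * (N%:R + 2) * h).
Proof.
move=> h0 d0 p kp; rewrite /Defs.eball /= edistC.
(* Coordinates deviate by at most (N+1) h; N+2 in the radius gives the strict inequality of an open
   ball. *)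
apply: (@le_lt_trans _ _ (d%:R * ((N%:R + 1) * h))); last first.
  by rewrite -mulrA ltr_pM2l ?ltr0n// ltr_pM2r// ltrD2l ltr1n.
apply: edist_le_coord => [|l]; first by rewrite mulr_ge0 ?addr_ge0// ltW.
have := kp l; rewrite /= /grid_side in_itv /= => /andP[k1 k2].
have kN : (k l)%:R <= N%:R + N%:R :> R.
  by rewrite -natrD ler_nat addnn -ltnS.
have k0 : 0 <= (k l)%:R :> R by [].
rewrite ler_distl; apply/andP; split.
  apply: le_trans k1; rewrite lerD2l mulrC -mulrN ler_pM2l//; lra.
apply: (le_trans (ltW k2)); rewrite lerD2l mulrC ler_pM2r//; lra.
Qed.

(** The defining limit is read at level [e] and multiplied by the volume of the ball, whose
    positivity and finiteness allow clearing the inverse. *)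
Lemma lebesgue_point_ball f x (e : R) : 0 < e -> lebesgue_point f x ->
  exists2 r : R, 0 < r & forall s : R, 0 < s -> s < r ->
    (0 < lebesgue R d (Defs.eball x s))%E ->
    (\int[lebesgue R d]_(u in Defs.eball x s) `|f u - f x|%:E <=
     e%:E * lebesgue R d (Defs.eball x s))%E.
Proof.
move=> e0 fx; have : nbhs (0 : \bar R)%E [set y : \bar R | (y < e%:E)%E].
  by apply: open_nbhs_nbhs; split; [exact: open_ereal_lt_ereal|rewrite /= lte_fin].
move=> /fx[r /= r0 H].
exists r => // s s0 sr B0; have := H s.
rewrite /= sub0r normrN gtr0_norm// => /(_ sr s0).
have B1 : lebesgue R d (Defs.eball x s) \is a fin_num.
  rewrite ge0_fin_numE ?measure_ge0//.
  exact: le_lt_trans (lebesgue_eball_le x s0) (ltry _).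
move: B0; rewrite -(fineK B1); set b := fine _; rewrite lte_fin => b0.
rewrite inver gt_eqF// => /ltW; rewrite muleC (lee_pdivrMr _ _ b0).
done.
Qed.

Lemma grid_cube_mass_ge (f : Rd R d -> R) x N : (0 < d)%N -> prob_density f ->
  lebesgue_point f x -> 0 < f x ->
  exists2 r : R, 0 < r & forall h : R, 0 < h -> h < r ->
    forall k : {ffun 'I_d -> 'I_(N.*2.+1)},
    ((f x / 2 * h ^+ d)%:E <= \int[lebesgue R d]_(u in grid_cube x h k) (f u)%:E)%E.
Proof.
move=> d0 [mf f0 _] fx fx0.
pose K : R := d%:R * (N%:R + 2).
have K0 : 0 < K by rewrite mulr_gt0 ?ltr0n// ltr_wpDl.
(* The ball of radius K h has volume at most (2 K h)^d, so this [e] bounds the integral of |f -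
   f(x)| over it by f(x) h^d / 2. *)
pose e : R := f x / 2 / (2 * K) ^+ d.
have e0 : 0 < e by rewrite !divr_gt0// exprn_gt0// mulr_gt0.
have [r r0 rB] := lebesgue_point_ball e0 fx.
exists (r / K); first by rewrite divr_gt0.
move=> h h0 hr k.
have Kh0 : 0 < K * h by rewrite mulr_gt0.
have Khr : K * h < r by rewrite mulrC -ltr_pdivlMr.
have mQ := measurable_grid_cube x h k.
have mB := measurable_eball x (K * h).
have QB := grid_cube_sub_eball h0 d0 : grid_cube x h k `<=` Defs.eball x (K * h).
have mdiff : measurable_fun setT (fun u : Rd R d => `|f u - f x|%:E).
  apply/measurable_EFinP; apply: measurableT_comp => //.
  exact: measurable_funB.
have B0 : (0 < lebesgue R d (Defs.eball x (K * h)))%E.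
  apply: (@lt_le_trans _ _ (lebesgue R d (grid_cube x h k))).
    by rewrite lebesgue_grid_cube// lte_fin exprn_gt0.
  by apply: le_measure; rewrite ?inE.
have small : (\int[lebesgue R d]_(u in grid_cube x h k) `|f u - f x|%:E <=
    (f x / 2 * h ^+ d)%:E)%E.
  apply: (@le_trans _ _
      (\int[lebesgue R d]_(u in Defs.eball x (K * h)) `|f u - f x|%:E)%E).
    apply: ge0_subset_integral => //; first exact: measurable_funTS.
  apply: (le_trans (rB _ Kh0 Khr B0)).
  apply: (@le_trans _ _ (e%:E * ((2 * (K * h)) ^+ d)%:E)%E).
    by apply: lee_wpmul2l; [rewrite lee_fin ltW|exact: lebesgue_eball_le].
  rewrite -EFinM lee_fin /e [2 * (K * h)]mulrA [(2 * K * h) ^+ d]exprMn mulrA divfK// gt_eqF//.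
  by rewrite exprn_gt0// mulr_gt0.
(* Integrates f(x) ≤ f(u) + |f(u) - f(x)| over the cube. *)
have : ((f x * h ^+ d)%:E <= \int[lebesgue R d]_(u in grid_cube x h k) (f u)%:E +
    \int[lebesgue R d]_(u in grid_cube x h k) `|f u - f x|%:E)%E.
  rewrite -ge0_integralD//; first last.
  - exact: measurable_funTS.
  - by apply/measurable_EFinP; exact: measurable_funTS.
  - by move=> u _; rewrite lee_fin.
  rewrite EFinM -(lebesgue_grid_cube x k h0) -integral_cst//.
  apply: ge0_le_integral => //.
  - by move=> u _; rewrite lee_fin ltW.
  - apply: emeasurable_funD; last exact: measurable_funTS.
    by apply/measurable_EFinP; exact: measurable_funTS.
  - move=> u _; rewrite /= -EFinD lee_fin -lerBlDl.
    by rewrite distrC; exact: ler_norm.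
move=> /le_trans/(_ (leeD2l _ small)).
rewrite -leeBlDr// -EFinB; apply: le_trans; rewrite lee_fin.
by rewrite -mulrBl ler_wpM2r ?exprn_ge0 ?(ltW h0)//; lra.
Qed.

End volumes.

(** * Union bound, independence and the upper limit *)

Section probability.
Set Implicit Arguments.
Unset Strict Implicit.

Lemma measure_bigcup_fin_le (dT : measure_display) (T : measurableType dT)
    (R : realType) (mu : {measure set T -> \bar R}) (I : finType)
    (A : I -> set T) (c : R) :
  (forall i, measurable (A i)) -> (forall i, (mu (A i) <= c%:E)%E) ->
  (mu (\bigcup_i A i) <= (#|I|%:R * c)%:E)%E.
Proof.
move=> mA Ac.
rewrite (_ : \bigcup_i A i = \big[setU/set0]_(i : I) A i); last first.
  apply/seteqP; split => w.
    by move=> [i _ Ai]; rewrite (bigD1 i)//=; left.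
  by elim/big_ind: _ => // [B C HB HC [/HB|/HC]//|i _ Ai]; exists i.
suff [] : measurable (\big[setU/set0]_(i : I) A i) /\
  (mu (\big[setU/set0]_(i : I) A i) <= (\sum_(i : I) c)%:E)%E.
  by rewrite sumr_const mulr_natl.
elim/big_rec2: _ => [|i r B _ [mB Br]]; first by rewrite measure0.
split; first exact: measurableU.
apply: (@le_trans _ _ (mu (A i) + mu B)%E); first exact: measureU2.
by rewrite EFinD; apply: leeD.
Qed.

Lemma measurable_all_avoid (dO : measure_display) (Omega : measurableType dO)
    (R : realType) (d : nat) (P : probability Omega R)
    (X : nat -> {RV P >-> Rd R d}) (A : set (Rd R d)) (n : nat) :
  measurable A -> measurable [set w | forall j : 'I_n, ~ A (X j w)].
Proof.
move=> mA; rewrite (_ : [set w | _] = \bigcap_(j : 'I_n) (X j @^-1` (~` A))).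
  apply: fin_bigcap_measurable => [|j _]; first exact: finite_finset.
  by rewrite -[X in measurable X]setTI; apply: measurable_funP => //; exact: measurableC.
by apply/seteqP; split => w H j => [_|]; exact: H.
Qed.

(** By independence the probability is a product of n factors, each at most 1 - m ≤ exp(-m). *)
Lemma prob_all_avoid_le (dO : measure_display) (Omega : measurableType dO)
    (R : realType) (d : nat) (P : probability Omega R)
    (X : nat -> {RV P >-> Rd R d}) (A : set (Rd R d)) (m : R) (n : nat) :
  mutually_independent X -> measurable A ->
  (forall j, (m%:E <= P (X j @^-1` A))%E) ->
  (P [set w | forall j : 'I_n, ~ A (X j w)] <= (expR (- (n%:R * m)))%:E)%E.
Proof.
move=> indX mA mP.
have mXA j : measurable (X j @^-1` A).
  by rewrite -[X in measurable X]setTI; exact: measurable_funP.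
rewrite (_ : [set w | _] = \bigcap_(i in [set` iota 0 n]) (X i @^-1` (~` A))).
  rewrite (indX _ (fun _ => ~` A)) ?iota_uniq// => [|_]; last exact: measurableC.
  have -> : expR (- (n%:R * m)) = \prod_(i <- iota 0 n) expR (- m).
    rewrite -expR_sum big_const_seq count_predT size_iota iter_addr addr0.
    by rewrite mulNrn mulr_natl.
  rewrite -prodEFin.
  suff /andP[] : (0 <= \prod_(i <- iota 0 n) P (X i @^-1` (~` A)) <=
      \prod_(i <- iota 0 n) (expR (- m))%:E)%E by [].
  elim/big_rec2: _ => [|i y z _ /andP[z0 zy]]; first by rewrite lee01 lexx.
  rewrite mule_ge0//= lee_pmul// preimage_setC probability_setC; last exact: mXA.
  apply: (@le_trans _ _ (1 - m%:E)%E); last by rewrite -EFinB lee_fin expR_ge1Dx.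
  by apply: leeB => //; exact: mP.
apply/seteqP; split => w /=.
  move=> H i; rewrite /= mem_iota add0n => /andP[_ ni]; exact: (H (Ordinal ni)).
by move=> H j; apply: (H j); rewrite /= mem_iota add0n ltn_ord.
Qed.

(** The upper limit is an infimum of suprema of [u] over the sets of the filter, and the set where u
    n ≤ a is one of them. *)
Lemma limn_esup_le_near (R : realType) (u : nat -> \bar R) (a : \bar R) :
  (\forall n \near \oo, (u n <= a)%E) -> (limn_esup u <= a)%E.
Proof.
move=> ua; apply: (@le_trans _ _ (ereal_sup (u @` [set n | (u n <= a)%E]))).
  by apply: ereal_inf_lbound; exists [set n | (u n <= a)%E].
by apply: ge_ereal_sup => _ [n un <-].
Qed.

End probability.

(** * Choice of the constants and assembly of the bounds *)

Theorem theorem1p3 (R : realType) (d : nat) (hd : (1 <= d)%N) :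
  exists c1 c2 : R, [/\ 0 < c1, 0 < c2 &
    forall (f : Rd R d -> R) (x : Rd R d),
      prob_density f -> lebesgue_point f x -> 0 < f x ->
    forall (dO : measure_display) (Omega : measurableType dO)
      (P : probability Omega R) (X : nat -> {RV P >-> Rd R d}),
      iid_with_density X f ->
    forall t : R, 0 < t ->
      (limn_esup (fun n : nat =>
         P [set w | (t / (n%:R `^ (d%:R^-1)))%:E <= cell_diameter X x n w])
       <= (c1 * expR (- (c2 * f x * t ^+ d)))%:E)%E].
Proof.
(* Twice the 6 d^2 of [diameter_cell_of_le]: if every cube of side t'/K is hit, the diameter is at
   most t'/2, below t'. *)
pose K : R := 12 * d%:R ^+ 2.
have d0 : 0 < d%:R :> R by rewrite ltr0n.
have K0 : 0 < K by rewrite mulr_gt0// exprn_gt0.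
(* [c1] counts the cubes; [c2] comes from the exponent n (f(x)/2) h^d, where h^d = t^d / (K^d n), so
   that n cancels. *)
exists #|{ffun 'I_d -> 'I_((3 * d).*2.+1)}|%:R, (2 * K ^+ d)^-1; split.
- by rewrite ltr0n card_ffun !card_ord expn_gt0.
- by rewrite invr_gt0 mulr_gt0// exprn_gt0.
move=> f x df lf fx0 dO Omega P X [indX densX] t t0.
have [r r0 mass] := grid_cube_mass_ge (3 * d) hd df lf fx0.
apply: limn_esup_le_near; near=> n.
have n0 : 0 < n%:R :> R by near: n; exact: nbhs_infty_gtr.
set t' := t / _; pose h := t' / K.
have t'0 : 0 < t' by rewrite divr_gt0// powR_gt0.
have h0 : 0 < h by rewrite divr_gt0.
have hE : h ^+ d = t ^+ d / K ^+ d / n%:R.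
  rewrite /h /t' !expr_div_n -[(_ `^ _) ^+ d]powR_mulrn ?powR_ge0// -powRrM mulVf ?gt_eqF//.
  by rewrite powRr1 ?ltW// mulrAC.
(* Comparing d-th powers, h < r holds as soon as n exceeds t^d / K^d / r^d. *)
have hr : h < r.
  rewrite ltNge; apply/negP => rh.
  have : r ^+ d <= h ^+ d by rewrite lerXn2r// nnegrE ltW.
  rewrite hE ler_pdivlMr// mulrC -ler_pdivlMr ?exprn_gt0//; apply/negP.
  by rewrite -ltNge; near: n; exact: nbhs_infty_gtr.
pose E (k : {ffun 'I_d -> 'I_((3 * d).*2.+1)}) :=
  [set w | forall j : 'I_n, ~ grid_cube x h k (X j w)].
have mE k : measurable (E k).
  by apply: measurable_all_avoid; exact: measurable_grid_cube.
apply: (@le_trans _ _ (P (\bigcup_k E k))).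
  apply: le_measure; rewrite ?inE.
  - by apply: (measurable_diameter_cell_of_ge (X := fun j : 'I_n => X j)) => j;
      exact: measurable_funPT.
  - by apply: fin_bigcup_measurable => [|k _]; first exact: finite_finset.
  move=> w /= tD; apply: contrapT => noE.
  have hit (k : {ffun 'I_d -> 'I_((3 * d).*2.+1)}) :
      exists j : 'I_n, grid_cube x h k (X j w).
    apply: contrapT => nohit; apply: noE; exists k => // j kj.
    by apply: nohit; exists j.
  have := le_trans tD (diameter_cell_of_le h0 hit).
  rewrite lee_fin /h /K; apply/negP; rewrite -ltNge.
  have -> : d%:R * (6 * d%:R * (t' / (12 * d%:R ^+ 2))) = t' / 2 :> R.
    by field; rewrite gt_eqF.
  lra.
apply: measure_bigcup_fin_le => // k.
apply: (le_trans (prob_all_avoid_le n indX (measurable_grid_cube x h k) (m := f x / 2 * h ^+ d) _)).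
  move=> j; have := densX j _ (measurable_grid_cube x h k).
  by rewrite /distribution /pushforward => ->; exact: mass.
rewrite lee_fin hE le_eqVlt; apply/orP; left; apply/eqP; congr (expR (- _)).
field.
by rewrite !gt_eqF// exprn_gt0.
Unshelve. all: by end_near.
Qed.
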